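(* Let $m\geq 2$ be an integer and let $a_1,\ldots,a_m$ be positive integers. Put $a=\min\{a_1,\ldots,a_m\}$ and $b=\sum_{i=1}^m a_i - a$. Let $R(a_1,\ldots,a_m)$ denote the least positive integer $n_0$ such that for every integer $n\geq n_0$ and every $2$-coloring $\Delta:[1,n]\to\{0,1\}$ of $[1,n]$, the equation $a_1x_1+\cdots+a_mx_m=x_0$ has a monochromatic solution with $x_0,x_1,\ldots,x_m\in[1,n]$. Then $$R(a_1,\ldots,a_m)=a(a+b)^2+b.$$
   Context: For nonnegative integers $s\le t$, $[s,t]=\{x\in\mathbb{Z}: s\leq x\leq t\}$. A $2$-coloring of $[1,n]$ is a function $\Delta:[1,n]\to\{0,1\}$. A solution $(x_0,\ldots,x_m)$ with all $x_i\in[1,n]$ is monochromatic if $\Delta(x_0)=\Delta(x_1)=\cdots=\Delta(x_m)$; the $x_i$ need not be distinct. (Such a least $n_0$ exists, by Rado's theorem.) *)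

(* Defs.v *)
From mathcomp Require Import all_boot.

Set Implicit Arguments.
Unset Strict Implicit.
Unset Printing Implicit Defensive.

Definition interval (s t : nat) := {x : nat | s <= x <= t}.

Definition coloring (n : nat) := interval 1 n -> bool.

(* The coefficient c i and the unknown x i, for i : 'I_m, stand for a_{i+1} and
   x_{i+1}. *)
Definition has_mono_solution (m : nat) (c : 'I_m -> nat) (n : nat)
    (Delta : coloring n) : Prop :=
  exists (x0 : interval 1 n) (x : 'I_m -> interval 1 n),
    \sum_(i < m) c i * val (x i) = val x0 /\
    (forall i : 'I_m, Delta (x i) = Delta x0).

Definition is_least (P : nat -> Prop) (k : nat) : Prop :=
  P k /\ (forall j : nat, P j -> k <= j).

Definition is_min_of (m : nat) (c : 'I_m -> nat) (a : nat) : Prop :=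
  is_least (fun k => exists i : 'I_m, c i = k) a.

(* "r is the number R(a_1, ..., a_m)"; the relational form also asserts that
   the least element exists. *)
Definition is_rado_number (m : nat) (c : 'I_m -> nat) (r : nat) : Prop :=
  is_least
    (fun n0 => 0 < n0 /\
       (forall n : nat, n0 <= n ->
        forall Delta : coloring n, has_mono_solution c Delta))
    r.

(* Main.v *)
(** Giving all unknowns but one the same value reduces the upper bound to
    [a x + b y = z] with [a <= b]; put [w = a + b] and [N = a w^2 + b].
    Assume that there is no monochromatic solution and that [1] has color [0];
    then [w], [w^2] and [N] have colors [1], [0] and [1].
    Write [a = g A] and [b = g B] with [A], [B] coprime.  If [r] and
    [s = r + A] have different colors, then [a x + b s = a (x + B) + b r] shows
    that [x + B] inherits the color of [x] whenever [x] has the color of [s];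
    such [r], [s] exist between any two numbers that have different colors and
    are congruent modulo [A].  The same holds with [A] and [B] exchanged.
    - If [a] and [b] have different colors, then
      [a b (w + 1) = a b + b (a w) = a (b w) + b a] is contradictory.
    - If both have color [0], then color [1] spreads from [w] by steps [A] and
      [B] as far as [a w + 1], which has color [0] because of
      [N = a (a w) + b (a w + 1)].
    - If both have color [1], then [a w] and [2 a b] have color [0], and color
      [0] spreads from [1] by steps [A] and [B] as far as
      [w + b A = a + b (1 + A)], which has color [1].

    The lower bound comes from giving [w, ..., w^2 - 1] one color and all other
    numbers the other color. *)
Require Import Defs.
From mathcomp Require Import all_boot zify.

(** * Sums of two coprime steps, and colors along arithmetic progressions *)

Lemma coprime_nat_comb (p q n : nat) : 0 < p -> 0 < q -> coprime p q ->
  p.-1 * q.-1 <= n -> exists i j, n = i * p + j * q.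
Proof.
move=> p0 q0 cpq le_n.
(* Sylvester-Frobenius bound: [y] is the multiple of [q] below [p * q] congruent to [n] modulo [p].
   If [y > n], then [n + p <= y <= p.-1 * q], which puts [n] below [p.-1 * q.-1]. *)
set y := chinese p q n 0 %% (p * q).
have y_p : y = n %[mod p].
  by rewrite /y modn_dvdm ?dvdn_mulr // chinese_modl.
have : q %| y.
  by rewrite /dvdn /y modn_dvdm ?dvdn_mull // chinese_modr // mod0n.
case/dvdnP=> j yE.
have lt_j : j < p.
  by rewrite -(ltn_pmul2r q0) -yE ltn_pmod // muln_gt0 p0.
have [le_y|lt_n] := leqP y n.
  have /dvdnP[i iE] : p %| n - y by rewrite -eqn_mod_dvd // y_p.
  by exists i, j; lia.
have /dvdnP[k kE] : p %| y - n by rewrite -eqn_mod_dvd ?y_p // ltnW.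
have k0 : 0 < k by lia.
have le_p : p <= k * p by rewrite leq_pmull.
have : j * q <= p.-1 * q by rewrite leq_mul2r; lia.
have -> : p.-1 * q = p.-1 * q.-1 + p.-1 by rewrite -{1}(prednK q0) mulnS addnC.
lia.
Qed.

Lemma color_change (f : nat -> bool) (r d k : nat) :
  f (r + k * d) = ~~ f r ->
  exists2 i, i < k & f (r + i * d) = f r /\ f (r + i.+1 * d) = ~~ f r.
Proof.
elim: k => [|k IHk] fk; first by move: fk; rewrite mul0n addn0; case: (f r).
have [eq_k|neq_k] := eqVneq (f (r + k * d)) (f r); first by exists k.
have [|i ltik fi] := IHk; last by exists i => //; lia.
by case: (f _) (f r) neq_k => [] [].
Qed.

Lemma color_spread (f : nat -> bool) (c : bool) (d M x i : nat) :
  (forall y, x <= y <= M -> f y = c -> f (y + d) = c) ->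
  f x = c -> x + i * d <= M + d -> f (x + i * d) = c.
Proof.
move=> step fx; elim: i => [|i IHi] le_M; first by rewrite mul0n addn0.
by rewrite mulSnr addnA; apply: step; [|apply: IHi]; lia.
Qed.

(** * The two-term equation without monochromatic solutions *)

Definition mono_free (a b n : nat) (f : nat -> bool) : Prop :=
  forall x y, 0 < x -> 0 < y -> a * x + b * y <= n -> f x = f y ->
  f (a * x + b * y) = ~~ f x.

Lemma mono_free_sym (a b n : nat) (f : nat -> bool) :
  mono_free a b n f -> mono_free b a n f.
Proof.
move=> free x y x0 y0 le_n fxy; rewrite addnC.
by rewrite free // ?[a * _ + _]addnC // fxy.
Qed.

(** Some step of length [p] between [r] and [s] changes the color. If [x + q] had the color opposite
    to [x], both sides of [zE] would come from monochromatic pairs, of opposite colors, and force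
    contradictory colors on the same number. *)
Lemma mono_free_shift {g p q n r s k x : nat} {f : nat -> bool} :
  mono_free (g * p) (g * q) n f -> 0 < r -> 0 < x -> s = r + k * p ->
  g * p * x + g * q * s <= n -> f r = ~~ f x -> f s = f x ->
  f (x + q) = f x.
Proof.
move=> free r0 x0 -> le_n fr fs.
have [|i ltik [fi fi1]] := color_change f r p k; first by rewrite fs fr negbK.
have le_n' : g * p * x + g * q * (r + i.+1 * p) <= n.
  apply: leq_trans le_n.
  by rewrite leq_add2l leq_mul2l leq_add2l leq_mul2r ltik !orbT.
have fz : f (g * p * x + g * q * (r + i.+1 * p)) = ~~ f x.
  by apply: free; rewrite ?fi1 ?fr ?negbK // addn_gt0 r0.
have zE : g * p * x + g * q * (r + i.+1 * p)
          = g * p * (x + q) + g * q * (r + i * p) by nia.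
have [//|neq] := eqVneq (f (x + q)) (f x).
have fq : f (x + q) = ~~ f x by case: (f (x + q)) (f x) neq => [] [].
have := free (x + q) (r + i * p); rewrite -zE fz fq fi fr.
by rewrite !addn_gt0 x0 r0 => /(_ isT isT le_n' erefl); case: (f x).
Qed.

Lemma mono_free_scale {a b n : nat} {f : nat -> bool} (x : nat) :
  mono_free a b n f -> 0 < x -> (a + b) * x <= n -> f ((a + b) * x) = ~~ f x.
Proof. by move=> free x0; rewrite mulnDl => le_n; apply: free. Qed.

Section NoMonochromaticSolution.

Context (a b : nat) (f : nat -> bool).

Local Notation w := (a + b).
Local Notation N := (a * w ^ 2 + b).

Hypotheses (a0 : 0 < a) (b0 : 0 < b) (free : mono_free a b N f).

Lemma color_w : f w = ~~ f 1.
Proof.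
by rewrite -[w]muln1 (mono_free_scale 1 free) ?muln1 //; nia.
Qed.

Lemma color_N : f N = ~~ f 1.
Proof.
have fw2 : f (w ^ 2) = f 1.
  by rewrite expnS expn1 (mono_free_scale w free) ?color_w ?negbK //; nia.
by have := free (w ^ 2) 1; rewrite fw2 muln1; apply => //; nia.
Qed.

Lemma color_wa : f (w * a) = ~~ f a.
Proof. by apply: mono_free_scale free _ _; nia. Qed.

Lemma color_b : f b = f a.
Proof.
have [//|neq] := eqVneq (f b) (f a).
have fb : f b = ~~ f a by case: (f b) (f a) neq => [] [].
have fwb : f (w * b) = f a.
  by rewrite (mono_free_scale b free) ?fb ?negbK //; nia.
(* The pair [w * b], [a] has the color of [a], while the pair [b], [w * a] has the other one. *)
have zE : a * (w * b) + b * a = a * b + b * (w * a) by nia.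
have le_z : a * (w * b) + b * a <= N by nia.
have wa0 : 0 < w * a by nia.
have wb0 : 0 < w * b by nia.
have := free (w * b) a wb0 a0 le_z fwb.
rewrite zE in le_z *.
by rewrite free // ?color_wa // fb fwb; case: (f a).
Qed.

Section CommonFactor.

Context (g p q : nat).
Hypotheses (aE : a = g * p) (bE : b = g * q) (cpq : coprime p q).

Let g0 : 0 < g. Proof. by move: a0; rewrite aE muln_gt0 => /andP[]. Qed.
Let p0 : 0 < p. Proof. by move: a0; rewrite aE muln_gt0 => /andP[]. Qed.
Let q0 : 0 < q. Proof. by move: b0; rewrite bE muln_gt0 => /andP[]. Qed.

Let free_pq : mono_free (g * p) (g * q) N f.
Proof. by rewrite -aE -bE. Qed.
Let free_qp : mono_free (g * q) (g * p) N f.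
Proof. exact: mono_free_sym. Qed.

Lemma color_a_neq : f a <> f 1.
Proof.
move=> fa; have fb : f b = f 1 by rewrite color_b.
(* The change of color is between [a] and [w = a + g * q]; the upper limit on [y] keeps
   [b * y + a * w] within [N]. *)
have step_p y : w <= y <= w * a -> f y = ~~ f 1 -> f (y + p) = ~~ f 1.
  move=> hy fy; rewrite -fy.
  apply: (mono_free_shift (r := a) (s := w) (k := g) free_qp) => //.
  - by lia.
  - by rewrite bE.
  - by rewrite -aE -bE; clear -a0 b0 hy; nia.
  - by rewrite fy fa negbK.
  - by rewrite color_w.
have step_q y : w <= y <= w * a -> f y = ~~ f 1 -> f (y + q) = ~~ f 1.
  move=> hy fy; rewrite -fy.
  apply: (mono_free_shift (r := b) (s := w) (k := g) free_pq) => //.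
  - by lia.
  - by rewrite addnC -aE.
  - by rewrite -aE -bE; clear -a0 b0 hy; nia.
  - by rewrite fy fb negbK.
  - by rewrite color_w.
have fwa1 : f (w * a + 1) = f 1.
  have [//|neq] := eqVneq (f (w * a + 1)) (f 1).
  have fneq : f (w * a + 1) = ~~ f 1 by case: (f _) (f 1) neq => [] [].
  have := free (w * a) (w * a + 1).
  have -> : a * (w * a) + b * (w * a + 1) = N by nia.
  rewrite color_N color_wa fa fneq muln_gt0 !addn_gt0 a0 orbT.
  by move=> /(_ isT isT (leqnn _) erefl); case: (f 1).
have [|i [j ijE]] := @coprime_nat_comb p q (w * a + 1 - w) p0 q0 cpq.
  have le_pa : p <= a by rewrite aE leq_pmull.
  have le_qb : q <= b by rewrite bE leq_pmull.
  have : p.-1 * q.-1 <= a.-1 * b.-1 by apply: leq_mul; lia.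
  by move/leq_trans; apply; clear -a0 b0; nia.
have le_wa : w <= w * a by rewrite leq_pmulr.
have fi : f (w + i * p) = ~~ f 1.
  by apply: color_spread step_p color_w _; lia.
have : f (w + i * p + j * q) = ~~ f 1.
  apply: (@color_spread f _ _ (w * a)) fi _; last by lia.
  by move=> y hy; apply: step_q; lia.
have -> : w + i * p + j * q = w * a + 1 by lia.
by rewrite fwa1; case: (f 1).
Qed.

Lemma color_a_eq : f a = f 1.
Proof.
have [//|neq] := eqVneq (f a) (f 1).
have fa : f a = ~~ f 1 by case: (f a) (f 1) neq => [] [].
have fb : f b = ~~ f 1 by rewrite color_b.
have f2ab : f (a * b + b * a) = f 1.
  by rewrite free ?fb ?fa ?negbK //; nia.
(* The change of color is now between [b] and [2 * a * b]; for [y <= a * b + 1] the sum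
   [b * y + a * (2 * a * b)] stays within [N]. *)
have step_p y : 1 <= y <= a * b + 1 -> f y = f 1 -> f (y + p) = f 1.
  move=> hy fy; rewrite -fy.
  apply: (mono_free_shift (r := b) (s := a * b + b * a)
            (k := g * (2 * a - 1)) free_qp) => //.
  - by lia.
  - have -> : g * (2 * a - 1) * q = b * (2 * a - 1) by rewrite bE; nia.
    by nia.
  - by rewrite -aE -bE; clear -a0 b0 hy; nia.
  - by rewrite fy fb.
  - by rewrite f2ab.
(* Here [a] and [w * a] differ in color, and [a * y + b * (w * a)] is at most [a * w ^ 2]. *)
have step_q y : 1 <= y <= w * a -> f y = f 1 -> f (y + q) = f 1.
  move=> hy fy; rewrite -fy.
  apply: (mono_free_shift (r := a) (s := w * a)
            (k := g * (w - 1)) free_pq) => //.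
  - by lia.
  - have -> : g * (w - 1) * p = a * (w - 1) by rewrite {1}aE; nia.
    by nia.
  - by rewrite -aE -bE; clear -a0 b0 hy; nia.
  - by rewrite fy fa.
  - by rewrite color_wa fa negbK.
have f1p : f (1 + p) = f 1 by apply: step_p => //; nia.
have le_pq : p + q <= p * q + 1 by nia.
have le_qb : q <= b by rewrite bE leq_pmull.
have le_T : w + b * p <= a * b + 1 + p + q.
  rewrite aE bE; case: (g) g0 => // h _.
  have : h * (p + q) <= h * (p * q + 1) by rewrite leq_mul2l le_pq orbT.
  have : h <= h * (h * (p * q)) by case: (h) => // k; clear -p0 q0; nia.
  by clear; nia.
have le_Tw : w + b * p <= w * a + q.
  rewrite aE bE; case: (g) g0 => // h _.
  have : h * q <= h * q * (h.+1 * p) by rewrite leq_pmulr // muln_gt0.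
  by clear -p0 q0; nia.
have fT : f (w + b * p) = ~~ f 1.
  have -> : w + b * p = a * 1 + b * (1 + p) by lia.
  apply: free; rewrite ?f1p // (leq_trans (_ : _ <= w * a + q)) //; first by lia.
  by apply: leq_trans (_ : w * a + b <= _); [lia|clear -a0 b0; nia].
have le_qbp : p * q <= b * p by rewrite mulnC leq_mul2r le_qb orbT.
(* One step [q] is set aside, to return as [j.+1]: by [le_T] the [p]-steps then end by
   [a * b + 1 + p], within the reach of [step_p]. *)
have [|i [j ijE]] := @coprime_nat_comb p q (w + b * p - 1 - q) p0 q0 cpq.
  by clear -le_qbp le_qb p0 q0 b0; nia.
have fi : f (1 + i * p) = f 1.
  apply: color_spread step_p erefl _; lia.
have : f (1 + i * p + j.+1 * q) = f 1.
  apply: (@color_spread f _ _ (w * a)) fi _; last by lia.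
  by move=> y hy; apply: step_q; lia.
have -> : 1 + i * p + j.+1 * q = w + b * p by lia.
by rewrite fT; case: (f 1).
Qed.

End CommonFactor.

End NoMonochromaticSolution.

Lemma mono_free_absurd (a b : nat) (f : nat -> bool) : 0 < a -> 0 < b ->
  ~ mono_free a b (a * (a + b) ^ 2 + b) f.
Proof.
move=> a0 b0 free; have g0 : 0 < gcdn a b by rewrite gcdn_gt0 a0.
have aE : a = gcdn a b * (a %/ gcdn a b) by rewrite mulnC divnK ?dvdn_gcdl.
have bE : b = gcdn a b * (b %/ gcdn a b) by rewrite mulnC divnK ?dvdn_gcdr.
have cpq : coprime (a %/ gcdn a b) (b %/ gcdn a b).
  by rewrite /coprime -(eqn_pmul2l g0) muln_gcdr -aE -bE muln1.
apply: (color_a_neq _ _ _ a0 b0 free _ _ _ aE bE cpq).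
exact: (color_a_eq _ _ _ a0 b0 free _ _ _ aE bE cpq).
Qed.

Lemma two_term_mono_solution (a b : nat) (f : nat -> bool) : 0 < a -> 0 < b ->
  exists x y, [/\ 0 < x, 0 < y, a * x + b * y <= a * (a + b) ^ 2 + b,
                  f y = f x & f (a * x + b * y) = f x].
Proof.
move=> a0 b0; set N := a * _ + b.
(* Bounding [x] and [y] by [N] makes the search finite, hence decidable without classical axioms. *)
have [/existsP[x /existsP[y]]|no_sol] := boolP [exists x : 'I_N.+1,
  [exists y : 'I_N.+1, [&& 0 < x, 0 < y, a * x + b * y <= N,
                           f y == f x & f (a * x + b * y) == f x]]].
  by case/and5P=> x0 y0 le_N /eqP fy /eqP fz; exists x, y.
case: (mono_free_absurd a b f a0 b0) => x y x0 y0 le_N fxy.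
have lt_x : x < N.+1 by rewrite ltnS (leq_trans _ le_N) //; nia.
have lt_y : y < N.+1 by rewrite ltnS (leq_trans _ le_N) //; nia.
have [fz|neq] := eqVneq (f (a * x + b * y)) (f x).
  case/existsP: no_sol; exists (Ordinal lt_x).
  by apply/existsP; exists (Ordinal lt_y); rewrite /= x0 y0 le_N fz fxy !eqxx.
by case: (f _) (f x) neq => [] [].
Qed.

(** * The upper bound for [m] coefficients *)

Lemma sum_neq_gt0 (m : nat) (c : 'I_m -> nat) (i : 'I_m) :
  1 < m -> (forall j, 0 < c j) -> 0 < \sum_(j < m | j != i) c j.
Proof.
move=> m1 c0; have [j neq_j] : exists j, j != i.
  have : 0 < #|predC1 i| by rewrite cardC1 card_ord -subn1 subn_gt0.
  by case/card_gt0P=> j; exists j.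
by rewrite (bigD1 j) //= addn_gt0 c0.
Qed.

Lemma has_mono_solution_of_two_term (m : nat) (c : 'I_m -> nat) (i : 'I_m)
    (b n : nat) (Delta : coloring n) :
  1 < m -> (forall j, 0 < c j) -> b = \sum_(j < m | j != i) c j ->
  c i * (c i + b) ^ 2 + b <= n -> has_mono_solution c Delta.
Proof.
move=> m1 c0 bE le_n.
(* The default [false] outside [[1, n]] is harmless: [x], [y] and the value of the sum all lie in
   the interval. *)
pose f k := if insub k : option (interval 1 n) is Some u then Delta u else false.
have fE (u : interval 1 n) : f (val u) = Delta u by rewrite /f valK.
have b0 : 0 < b by rewrite bE sum_neq_gt0.
have [x [y [x0 y0 le_N fy fz]]] := two_term_mono_solution (c i) b f (c0 i) b0.
have le_z := leq_trans le_N le_n; have ci0 := c0 i.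
have hx : 1 <= x <= n by rewrite x0; apply: leq_trans le_z; nia.
have hy : 1 <= y <= n by rewrite y0; apply: leq_trans le_z; nia.
have hz : 1 <= c i * x + b * y <= n by rewrite le_z andbT; nia.
pose X : interval 1 n := exist _ x hx; pose Y : interval 1 n := exist _ y hy.
pose Z : interval 1 n := exist _ (c i * x + b * y) hz.
exists Z, (fun j => if j == i then X else Y); split=> [|j].
  rewrite (bigD1 i) //= eqxx bE big_distrl /=; congr (_ + _).
  by apply: eq_bigr => j /negPf->.
by rewrite -!fE /= fz; case: ifP.
Qed.

(** * The lower bound *)

Definition block_coloring (w n : nat) : coloring n := fun u => w <= val u < w ^ 2.

(** Always [x0 >= w]. If [x0] is in the block, all unknowns are at least [w], so [x0 >= w ^ 2].
    Otherwise either some unknown reaches [w ^ 2] and [x0] exceeds [n], or all are below [w] and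
    [x0 <= w * w.-1]. *)
Lemma block_coloring_no_mono_solution (m : nat) (c : 'I_m -> nat) (a n : nat) :
  (forall j, 0 < c j) -> (forall j, a <= c j) ->
  n < a * (\sum_(j < m) c j) ^ 2 + (\sum_(j < m) c j - a) ->
  ~ has_mono_solution c (block_coloring (\sum_(j < m) c j) n).
Proof.
set w := \sum_(j < m) c j => c0 min_a lt_n [x0 [x [xE mono]]].
have x_gt0 j : 0 < val (x j) by case/andP: (valP (x j)).
have /andP[_ x0_n] := valP x0.
have w_le_x0 : w <= val x0.
  by rewrite -xE; apply: leq_sum => j _; rewrite leq_pmulr.
have [x0_w2|w2_x0] := ltnP (val x0) (w ^ 2).
  have xw j : w <= val (x j).
    by have := mono j; rewrite /block_coloring x0_w2 w_le_x0 => /andP[].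
  suff : w ^ 2 <= val x0 by rewrite leqNgt x0_w2.
  rewrite -xE expnS expn1 {1}/w big_distrl /=.
  by apply: leq_sum => j _; rewrite leq_mul2l xw orbT.
have x_out j : val (x j) < w \/ w ^ 2 <= val (x j).
  have := mono j; rewrite /block_coloring [val x0 < _]ltnNge w2_x0 andbF.
  by case: (leqP w) => [_|]; [case: ltnP; [|right]|left].
have [/existsP[j w2_xj]|] := boolP [exists j, w ^ 2 <= val (x j)].
  suff : a * w ^ 2 + (w - a) <= val x0.
    by move=> /leq_trans/(_ x0_n); rewrite leqNgt lt_n.
  have cj_w : c j <= w by rewrite /w (bigD1 j) //= leq_addr.
  have rest : w - c j <= \sum_(k < m | k != j) c k * val (x k).
    rewrite {1}/w (bigD1 j) //= addKn.
    by apply: leq_sum => k _; apply: leq_pmulr; apply: x_gt0.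
  rewrite -xE (bigD1 j) //=.
  apply: leq_trans (leq_add (leq_mul (leqnn _) w2_xj) rest).
  (* [c j * w ^ 2 + (w - c j)] grows with [c j], so [a] is the extreme case. *)
  by have := min_a j; have := c0 j; nia.
rewrite negb_exists => /forallP x_small.
suff : val x0 < w ^ 2 by rewrite ltnNge w2_x0.
have x_lt j : val (x j) <= w.-1.
  by case: (x_out j); [lia|rewrite (negPf (x_small j))].
have : val x0 <= w * w.-1.
  rewrite -xE {1}/w big_distrl /=.
  by apply: leq_sum => j _; rewrite leq_mul2l x_lt orbT.
have x0_gt0 : 0 < val x0 by case/andP: (valP x0).
by move: (val x0) x0_gt0 => t; case: (w) => [|v]; nia.
Qed.

Theorem theorem1p1 (m : nat) (c : 'I_m -> nat) (a b : nat)
    (hm : 2 <= m) (hc : forall i : 'I_m, 0 < c i)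
    (ha : is_min_of c a) (hb : b = \sum_(i < m) c i - a) :
  is_rado_number c (a * (a + b) ^ 2 + b).
Proof.
have [[i ciE] min_a] := ha.
have wE : a + b = \sum_(j < m) c j.
  by rewrite hb subnKC // -ciE (bigD1 i) //= leq_addr.
have a0 : 0 < a by rewrite -ciE.
split=> [|j [_ hj]].
  split=> [|n le_n Delta]; first by nia.
  apply: (has_mono_solution_of_two_term _ _ i b) => //; last by rewrite ciE.
  by rewrite hb (bigD1 i) //= ciE addKn.
rewrite leqNgt; apply/negP => lt_j.
apply: (block_coloring_no_mono_solution _ c a j) (hj _ (leqnn j) _) => //.
- by move=> k; apply: min_a; exists k.
- by rewrite -hb -wE.
Qed.
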